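(* Let $C_{n_1}^{n_2}$ be the lollipop graph with parameters $n_1\ge3$, $n_2\ge2$. For $0\le h\le n_1+n_2-2$, the number $P_h(C_{n_1}^{n_2})$ of paths with length $h$ in $C_{n_1}^{n_2}$ is as follows. (a) If $h\in\{0,1\}$: $P_h=n_1+n_2-1$. (b) If $h\ge2$ and $n_2\le n_1$: $$P_h=\begin{cases}n_1+n_2+h-2, & 2\le h\le n_2-1,\\ n_1+2n_2-2, & n_2\le h\le n_1-1,\\ 2n_1+2n_2-2h-2, & n_1\le h\le n_1+n_2-2.\end{cases}$$ (c) If $h\ge2$ and $n_1<n_2$: $$P_h=\begin{cases}n_1+n_2+h-2, & 2\le h\le n_1-1,\\ 2n_1+n_2-h-2, & n_1\le h\le n_2-1,\\ 2n_1+2n_2-2h-2, & n_2\le h\le n_1+n_2-2.\end{cases}$$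
   Context: Graphs are finite and simple. A path of length $h$ in $G$ is a subgraph that is a path with $h$ edges ($h+1$ distinct vertices); paths are undirected, and paths of length $0$ are single vertices. $P_h(G)$ is the number of paths of length $h$ in $G$. The lollipop graph $C_{n_1}^{n_2}$ is obtained from the cycle $C_{n_1}$ on $n_1$ vertices and the path $P_{n_2}$ on $n_2$ vertices by identifying one vertex of $C_{n_1}$ with a pendant (end) vertex $x$ of $P_{n_2}$; thus it has $n_1+n_2-1$ vertices and $x$ has degree $3$ in it. Its longest path has length $n_1+n_2-2$. *)

(* Defs.v *)
From mathcomp Require Import all_boot.

Set Implicit Arguments.
Unset Strict Implicit.
Unset Printing Implicit Defensive.

Record sgraph := SGraph {
  vertex :> finType;
  adj : rel vertex;
  adj_sym : symmetric adj;
  adj_irrefl : irreflexive adj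
}.

Definition edges (G : sgraph) : {set {set G}} :=
  [set [set p.1; p.2] | p : G * G & adj p.1 p.2].

(* The path P_n on n vertices: 0 - 1 - ... - (n-1). *)
Definition path_adj (n : nat) : rel 'I_n :=
  fun i j => (i.+1 == j :> nat) || (j.+1 == i :> nat).

Lemma path_adj_sym n : symmetric (@path_adj n).
Proof. by move=> i j; rewrite /path_adj orbC. Qed.

Lemma path_adj_irrefl n : irreflexive (@path_adj n).
Proof. by move=> i; rewrite /path_adj orbb gtn_eqF. Qed.

Definition path_graph (n : nat) : sgraph :=
  SGraph (@path_adj_sym n) (@path_adj_irrefl n).

(* The cycle C_n on n vertices, for n >= 3; the conjunct i != j only matters
   for n = 1, where it removes the loop. *)
Definition cycle_adj (n : nat) : rel 'I_n :=
  fun i j => (i != j) &&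
    ((i.+1 %% n == j :> nat) || (j.+1 %% n == i :> nat)).

Lemma cycle_adj_sym n : symmetric (@cycle_adj n).
Proof. by move=> i j; rewrite /cycle_adj eq_sym orbC. Qed.

Lemma cycle_adj_irrefl n : irreflexive (@cycle_adj n).
Proof. by move=> i; rewrite /cycle_adj eqxx. Qed.

Definition cycle_graph (n : nat) : sgraph :=
  SGraph (@cycle_adj_sym n) (@cycle_adj_irrefl n).

(* The graph obtained from the disjoint union of G1 and G2 by identifying
   x in G1 with y in G2. The merged vertex is inl x; the other vertices of G2
   are kept as inr b with val b != y. *)
Section Coalescence.
Variables (G1 G2 : sgraph) (x : G1) (y : G2).

Definition coalesce_vertex : finType := (G1 + {b : G2 | b != y})%type.

Definition coalesce_adj : rel coalesce_vertex :=
  fun u v => match u, v with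
  | inl a, inl b => adj a b
  | inr a, inr b => adj (val a) (val b)
  | inl a, inr b => (a == x) && adj y (val b)
  | inr a, inl b => (b == x) && adj y (val a)
  end.

Lemma coalesce_adj_sym : symmetric coalesce_adj.
Proof. by move=> [a|a] [b|b] //=; exact: adj_sym. Qed.

Lemma coalesce_adj_irrefl : irreflexive coalesce_adj.
Proof. by move=> [a|a] /=; exact: adj_irrefl. Qed.

Definition coalesce : sgraph := SGraph coalesce_adj_sym coalesce_adj_irrefl.

End Coalescence.

(* C_{n1}^{n2}: vertex 0 of the cycle is identified with the end vertex 0 of
   the path. *)
Definition lollipop (n1 n2 : nat) (n1_ge3 : 3 <= n1) (n2_ge2 : 2 <= n2) :
    sgraph :=
  @coalesce (cycle_graph n1) (path_graph n2)
    (Ordinal (ltnW (ltnW n1_ge3))) (Ordinal (ltnW n2_ge2)).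

(* A pair H = (vertex set, edge set) which is a subgraph of G. *)
Definition is_subgraph (G : sgraph) (H : {set G} * {set {set G}}) : bool :=
  (H.2 \subset edges G) && [forall e in H.2, e \subset H.1].

(* H is isomorphic, as a graph, to the path with h edges and h + 1 vertices. *)
Definition is_path (G : sgraph) (h : nat) (H : {set G} * {set {set G}}) : bool :=
  [exists f : {ffun path_graph h.+1 -> G},
    [&& injectiveb f,
        H.1 == [set f i | i : path_graph h.+1]
      & H.2 == [set f @: e | e : {set path_graph h.+1} in edges (path_graph h.+1)]]].

(* P_h(G): paths are counted as subgraphs, hence without orientation. *)
Definition num_paths (G : sgraph) (h : nat) : nat :=
  #|[set H : {set G} * {set {set G}} | is_subgraph H && is_path h H]|.

(* Main.v *)
(* Number the vertices from the free end of the tail along the tail and then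
   around the cycle.  With m = n2 - 1 and N = m + n1 vertices, the lollipop is
   the path 0 - 1 - ... - (N-1) with the chord {m, N-1} added.  A path avoiding
   the chord is an interval.  A path through the chord, read so that it crosses
   from m to N-1, reaches m either from below (along the tail) or from above
   (along the cycle), and after the chord descends from N-1.  These three
   families are pairwise distinct up to reversal, and counting their parameters
   gives P_h. *)
Require Import Defs.
From HB Require Import structures.
From mathcomp Require Import all_boot zify.

Set Implicit Arguments.
Unset Strict Implicit.
Unset Printing Implicit Defensive.

Lemma set2_eq (T : finType) (a b c d : T) : [set a; b] = [set c; d] ->
  (a = c /\ b = d) \/ (a = d /\ b = c).
Proof.
move=> E.
have := set21 a b; have := set22 a b; rewrite E.
have := set21 c d; have := set22 c d; rewrite -{1 2}E.
move=> /set2P[?|?] /set2P[?|?] /set2P[?|?] /set2P[?|?];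
  by [left; split; congruence | right; split; congruence].
Qed.

(** * Path subgraphs as traces of injective walks, determined up to reversal *)

Section PathSubgraphs.
Variable G : sgraph.
Implicit Types (f g : nat -> G) (h : nat).

(** Walks are total functions on [nat] of which only the values up to [h] matter, so reversing or
    shifting indices needs no casts between ordinals. *)
Definition graph_walk h f : Prop :=
  (forall i, i < h -> adj (f i) (f i.+1)) /\
  (forall i j, i <= h -> j <= h -> f i = f j -> i = j).

Definition path_subgraph h f : {set G} * {set {set G}} :=
  ([set f (val i) | i : 'I_h.+1], [set [set f (val i); f i.+1] | i : 'I_h]).

Lemma eq_path_subgraph h f g : (forall i, i <= h -> f i = g i) ->
  path_subgraph h f = path_subgraph h g.
Proof.
move=> fg; rewrite /path_subgraph; congr pair; apply: eq_imset => i.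
  by apply: fg; exact: (ltn_ord i).
by congr [set _; _]; apply: fg; [apply: ltnW|]; exact: ltn_ord.
Qed.

Lemma rev_path_subgraph h f :
  path_subgraph h (fun k => f (h - k)) = path_subgraph h f.
Proof.
congr pair; apply/setP=> x; apply/imsetP/imsetP=> -[i _ ->].
- by exists (rev_ord i); rewrite //= subSS.
- by exists (rev_ord i); rewrite //= subSS subKn // -ltnS.
- exists (rev_ord i) => //=; rewrite setUC; congr [set f _; f _];
  have := ltn_ord i; lia.
- exists (rev_ord i) => //=; rewrite setUC; congr [set f _; f _];
  have := ltn_ord i; lia.
Qed.

Lemma path_subgraphP h (H : {set G} * {set {set G}}) :
  reflect (exists2 f, graph_walk h f & H = path_subgraph h f)
    (is_subgraph H && is_path h H).
Proof.
have edgeE (f : nat -> G) (i : 'I_h) : [set f i; f i.+1] =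
   [set f (val j) | j in [set widen_ord (leqnSn h) i; lift ord0 i]].
  by rewrite imsetU1 imset_set1.
(* The edges of [path_graph h.+1] are exactly the pairs of consecutive ordinals; [setUC] absorbs the
   order in which such a pair is listed. *)
have edge_path (f : nat -> G) (e : {set G}) :
    e \in [set [set f (val j) | j in e' : {set 'I_h.+1}]
             | e' in edges (path_graph h.+1)] <->
    e \in [set [set f (val i); f i.+1] | i : 'I_h].
  split.
    case/imsetP=> e' /imsetP[[j k]]; rewrite inE /= => jk -> ->{e e'}.
    rewrite imsetU1 imset_set1; apply/imsetP.
    case/orP: jk => /eqP jk.
      have jh : j < h by rewrite -ltnS jk.
      by exists (Ordinal jh); rewrite //= jk.
    have kh : k < h by rewrite -ltnS jk.
    by exists (Ordinal kh); rewrite //= setUC jk.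
  case/imsetP=> i _ ->; rewrite edgeE; apply: imset_f.
  apply/imsetP; exists (widen_ord (leqnSn h) i, lift ord0 i) => //.
  by rewrite inE /= /path_adj /= eqxx.
apply: (iffP andP).
  case=> /andP[/subsetP sub _] /existsP[f /and3P[/injectiveP f_inj /eqP V /eqP E]].
  pose f' k := f (inord k).
  have fE (i : 'I_h.+1) : f' (val i) = f i by rewrite /f' inord_val.
  have HE : H = path_subgraph h f'.
    rewrite [H]surjective_pairing /path_subgraph; congr pair.
      by rewrite V; apply: eq_imset.
    apply/setP=> e; apply/idP/idP.
      move=> eH; apply/edge_path; move: eH; rewrite E => /imsetP[e' e'p ->].
      by apply/imsetP; exists e' => //; apply: eq_imset => i; rewrite fE.
    move/edge_path/imsetP=> [e' e'p ->]; rewrite E; apply/imsetP; exists e' => //.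
    by apply: eq_imset.
  exists f' => //; split=> [i ih|i j ih jh].
    have: [set f' i; f' i.+1] \in edges G.
      apply: sub; rewrite HE /=; apply/imsetP; by exists (Ordinal ih).
    case/imsetP=> -[u v]; rewrite inE /= => uv /set2_eq[] [-> ->] //.
    by rewrite adj_sym.
  by move/f_inj/(congr1 (@nat_of_ord _)); rewrite !inordK.
case=> f [f_adj f_inj] ->; split.
  apply/andP; split.
    apply/subsetP=> _ /imsetP[i _ ->]; apply/imsetP.
    by exists (f i, f i.+1); rewrite // inE; apply: f_adj.
  apply/forallP=> e; apply/implyP=> /imsetP[i _ ->]; rewrite edgeE.
  by apply/subsetP=> _ /imsetP[j _ ->]; apply: imset_f.
apply/existsP; exists [ffun i => f (val i)]; apply/and3P; split.
- apply/injectiveP=> i j; rewrite !ffunE => /f_inj e.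
  by apply: val_inj; apply: e; [exact: (@ltn_ord h.+1 i)|exact: (@ltn_ord h.+1 j)].
- by apply/eqP; apply: eq_imset => i; rewrite ffunE.
- apply/eqP/setP=> e; apply/idP/idP.
    move/edge_path/imsetP=> [e' e'p ->]; apply/imsetP; exists e' => //.
    by apply: eq_imset => i; rewrite ffunE.
  case/imsetP=> e' e'p ->; apply/edge_path; apply/imsetP; exists e' => //.
  by apply: eq_imset => i; rewrite ffunE.
Qed.

(* An edge shared by f and g fixes the relative orientation, and injectivity
   forces the next edges of g to follow f in the same direction. *)
Lemma path_subgraph_inj h f g : graph_walk h f -> graph_walk h g ->
  path_subgraph h f = path_subgraph h g ->
  (forall i, i <= h -> g i = f i) \/ (forall i, i <= h -> g i = f (h - i)).
Proof.
move=> [_ f_inj] [_ g_inj] [V E].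
have step i : i < h -> exists2 j, j < h &
    (g i = f j /\ g i.+1 = f j.+1) \/ (g i = f j.+1 /\ g i.+1 = f j).
  move=> ih; have: [set g i; g i.+1] \in [set [set g (val i); g i.+1] | i : 'I_h].
    by apply/imsetP; exists (Ordinal ih).
  by rewrite -E => /imsetP[j _ /set2_eq]; exists j.
case: h => [|h] in f_inj g_inj V E step *.
  (* With length 0 there is no edge to orient; the vertex sets decide. *)
  left=> -[|//] _.
  have: g 0 \in [set g (val i) | i : 'I_1] by apply/imsetP; exists ord0.
  by rewrite -V => /imsetP[i _ ->]; rewrite ord1.
have [j jh [[e0 e1]|[e0 e1]]] := step 0 isT.
  have up i : i <= h -> i + j <= h /\ g i = f (i + j) /\ g i.+1 = f (i + j).+1.
    elim: i => [|i IH] ih; first by rewrite add0n.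
    have [le_ij [gi gi1]] := IH (ltnW ih).
    have [k kh [[a b]|[a b]]] := step i.+1 ih; move: a; rewrite gi1 => /f_inj kE.
      have {}kE : k = (i + j).+1 by rewrite kE //; lia.
      by rewrite addSn -kE -ltnS kh b.
    have {}kE : k = i + j by suff: (i + j).+1 = k.+1; [lia|apply: kE; lia].
    have : i.+2 = i by apply: g_inj; [lia|lia|rewrite b gi kE].
    lia.
  (* The last edge of [g] sits at position [h + j] of [f], where the last position is [h]. *)
  have j0 : j = 0 by have [] := up h (leqnn _); lia.
  left=> -[|i] ih; first by rewrite e0 j0.
  by have [_ [_ ->]] := up i ih; rewrite j0 addn0.
have down i : i <= h -> i <= j /\ g i = f (j - i).+1 /\ g i.+1 = f (j - i).
  elim: i => [|i IH] ih; first by rewrite subn0.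
  have [le_ij [gi gi1]] := IH (ltnW ih).
  have [k kh [[a b]|[a b]]] := step i.+1 ih; move: a; rewrite gi1 => /f_inj kE.
    have {}kE : k = j - i by rewrite kE //; lia.
    have : i.+2 = i by apply: g_inj; [lia|lia|rewrite b gi kE].
    lia.
  have {}kE : k.+1 = j - i by rewrite kE //; lia.
  have kE' : k = j - i.+1 by lia.
  by rewrite -kE' b kE; split=> //; lia.
have j0 : j = h by have [] := down h (leqnn _); lia.
right=> -[|i] ih; first by rewrite e0 j0 subn0.
by have [_ [_ ->]] := down i ih; rewrite j0 subSS.
Qed.

End PathSubgraphs.

(** * Classification of the paths in the chorded path on the numbers below [m + n] *)

Section NatPaths.
Variables m n : nat.
Hypothesis n_ge3 : 3 <= n.

Definition chord_adj (u v : nat) : bool :=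
  [|| v == u.+1, u == v.+1, (u == m) && (v == m + n.-1)
    | (v == m) && (u == m + n.-1)].

Lemma chord_adjP u v : reflect
  (v = u.+1 \/ u = v.+1 \/ (u = m /\ v.+1 = m + n) \/ (v = m /\ u.+1 = m + n))
  (chord_adj u v).
Proof. by apply: (iffP idP); rewrite /chord_adj; lia. Qed.

(* With N = m + n, parameter i and k running through 0 <= k <= h:
   Window:     i, i+1, ..., i+h;
   TailChord:  m-i, ..., m-1, m, N-1, N-2, ...;
   CycleChord: m+i, ..., m+1, m, N-1, N-2, ....
   CycleChord has i > 0 so as not to repeat TailChord at i = 0. *)
Inductive path_kind := Window | TailChord | CycleChord.

Definition path_fun (c : path_kind) (i k : nat) : nat :=
  match c with
  | Window => i + k
  | TailChord => if k <= i then m - i + k else m + n - (k - i)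
  | CycleChord => if k <= i then m + i - k else m + n - (k - i)
  end.

(** For the chord kinds, [i < h] says that the chord, crossed from position [i] to [i.+1], belongs
    to the path. The last bound keeps the descent from [m + n - 1] clear of the visited vertices:
    above [m] for [TailChord], above [m + i] for [CycleChord]. *)
Definition path_valid (c : path_kind) (h i : nat) : bool :=
  match c with
  | Window => i + h < m + n
  | TailChord => [&& i <= m, i < h & h < i + n]
  | CycleChord => [&& 0 < i, i < h & h < n]
  end.

Definition nat_walk (h : nat) (f : nat -> nat) : Prop :=
  [/\ forall i, i <= h -> f i < m + n,
      forall i, i < h -> chord_adj (f i) (f i.+1)
    & forall i j, i <= h -> j <= h -> f i = f j -> i = j].

Lemma path_fun_walk c h i : path_valid c h i -> nat_walk h (path_fun c i).
Proof.
case: c => /=; last 2 first; [case/and3P=> v1 v2 v3|case/and3P=> v1 v2 v3|move=> v1];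
  (split => [k kh|k kh|k l kh lh] /=; [|apply/chord_adjP|]);
  (do ?case: ifP => ?); lia.
Qed.

(* Induction on the length: the new last vertex u is a fresh neighbour of an end
   of a path of the list, so it prolongs that path at its end or its start. *)
Lemma nat_walkP h f : nat_walk h f -> exists c i, path_valid c h i /\
  ((forall k, k <= h -> f k = path_fun c i k) \/
   (forall k, k <= h -> f k = path_fun c i (h - k))).
Proof.
elim: h => [|h IH] [f_lt f_adj f_inj].
  exists Window, (f 0) => /=; split; first by rewrite addn0 f_lt.
  by left; case=> // _; rewrite addn0.
have [|c [i [v E]]] := IH.
  split=> [k kh|k kh|k l kh lh]; [apply: f_lt|apply: f_adj|apply: f_inj]; lia.
have fS := f_lt h.+1 (leqnn _); have := f_adj h (leqnn _).
have fresh k : k <= h -> f h.+1 <> f k.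
  by move=> kh /f_inj; lia.
set u := f h.+1 in fS fresh *.
have ext_last c' i' : path_valid c' h.+1 i' -> u = path_fun c' i' h.+1 ->
    (forall k, k <= h -> f k = path_fun c' i' k) ->
    exists c i, path_valid c h.+1 i /\
      ((forall k, k <= h.+1 -> f k = path_fun c i k) \/
       (forall k, k <= h.+1 -> f k = path_fun c i (h.+1 - k))).
  move=> v' uE fE; exists c', i'; split=> //; left=> k.
  by rewrite leq_eqVlt => /predU1P[->//|]; apply: fE.
have ext_first c' i' : path_valid c' h.+1 i' -> u = path_fun c' i' 0 ->
    (forall k, k <= h -> f k = path_fun c' i' (h.+1 - k)) ->
    exists c i, path_valid c h.+1 i /\
      ((forall k, k <= h.+1 -> f k = path_fun c i k) \/
       (forall k, k <= h.+1 -> f k = path_fun c i (h.+1 - k))).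
  move=> v' uE fE; exists c', i'; split=> //; right=> k.
  by rewrite leq_eqVlt => /predU1P[->|]; [rewrite subnn | apply: fE].
move/chord_adjP.
have Ef k w : k <= h -> f k = w -> u <> w by move=> kh <-; apply: fresh.
(* Six cases: the kind of the shorter path and the direction in which [f] runs along it. Each splits
   by the four ways in which [u] can be adjacent to the current end. *)
case: c v E => /= [v|/and3P[v1 v2 v3]|/and3P[v1 v2 v3]] [E|E]; rewrite E //;
  have F k kh := Ef k _ kh (E k kh); clear IH f_adj f_inj Ef f_lt fresh.
(* [F1] excludes turning back; [Fm] excludes closing the cycle at [m] when the window contains
   [m]. *)
- have F1 := F h.-1 (leq_pred _); have Fm := F (m - i).
  case=> [e|[e|[e|e]]].
  + by apply: (ext_last Window i) => [||k kh] /=; rewrite ?E //; do ?case: ifP; lia.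
  + by apply: (ext_first Window u) => [||k kh] /=; rewrite ?E //; do ?case: ifP; lia.
  + by apply: (ext_last TailChord h) => [||k kh] /=; rewrite ?E //; do ?case: ifP; lia.
  + by apply: (ext_first TailChord 0) => [||k kh] /=; rewrite ?E //; do ?case: ifP; lia.
- have F1 := F h.-1 (leq_pred _); have F0 := F 0 (leq0n _).
  case=> [e|[e|[e|e]]].
  + by apply: (ext_last Window i) => [||k kh] /=; rewrite ?E //; do ?case: ifP; lia.
  + by apply: (ext_first Window u) => [||k kh] /=; rewrite ?E //; do ?case: ifP; lia.
  (* The walk came down the cycle to [m]. If [h = 0] it is [m] alone, and the convention [0 < i] for
     [CycleChord] makes the extension [TailChord 0]. *)
  + have [h0|h0] := posnP h.
      by apply: (ext_last TailChord 0) => [||k kh] /=; rewrite ?E //; do ?case: ifP; lia.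
    by apply: (ext_last CycleChord h) => [||k kh] /=; rewrite ?E //; do ?case: ifP; lia.
  + by apply: (ext_first TailChord 0) => [||k kh] /=; rewrite ?E //; do ?case: ifP; lia.
- have Fi := F i (ltnW v2); rewrite leqnn in Fi.
  have := F h.-1 (leq_pred _); rewrite (leqNgt h) v2 /=.
  case: ifP => ? F1 [e|[e|[e|e]]]; try lia.
    by apply: (ext_last TailChord i) => [||k kh] /=; rewrite ?E //; do ?case: ifP; lia.
  by apply: (ext_last TailChord i) => [||k kh] /=; rewrite ?E //; do ?case: ifP; lia.
- have := F 0 (leq0n _); rewrite subn0 (leqNgt h) v2 subnn leq0n addn0 /= => F0.
  have := F (h - i.+1) (leq_subr _ _); rewrite subKn // ltnn => Fi.
  (* If [i = 0], the walk has just crossed the chord to [m] and may continue into the cycle or into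
     the tail; otherwise it is already in the tail. *)
  have [i0|i0] := posnP i; case=> [e|[e|[e|e]]]; try lia.
  + by apply: (ext_first CycleChord 1) => [||k kh] /=; rewrite ?E //; do ?case: ifP; lia.
  + by apply: (ext_first TailChord i.+1) => [||k kh] /=; rewrite ?E //; do ?case: ifP; lia.
  + have := F h.-1 (leq_pred _); rewrite (_ : h - h.-1 = 1) ?i0; lia.
  + by apply: (ext_first TailChord i.+1) => [||k kh] /=; rewrite ?E //; do ?case: ifP; lia.
- have Fi := F i (ltnW v2); rewrite leqnn in Fi.
  have F0 := F 0 (leq0n _); rewrite leq0n in F0.
  have := F h.-1 (leq_pred _); rewrite (leqNgt h) v2 /=.
  case: ifP => ? F1 [e|[e|[e|e]]]; try lia.
    by apply: (ext_last CycleChord i) => [||k kh] /=; rewrite ?E //; do ?case: ifP; lia.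
  by apply: (ext_last CycleChord i) => [||k kh] /=; rewrite ?E //; do ?case: ifP; lia.
- have := F 0 (leq0n _); rewrite subn0 (leqNgt h) v2 subnn leq0n subn0 /= => F0.
  have := F h.-1 (leq_pred _); rewrite (_ : h - h.-1 = 1) ?v1; last lia.
  move=> F1 [e|[e|[e|e]]]; try lia.
  by apply: (ext_first CycleChord i.+1) => [||k kh] /=; rewrite ?E //; do ?case: ifP; lia.
Qed.

(** A window moves by 1 at each step, whereas a chord path jumps by [n.-1 >= 2] where it crosses the
    chord. Paths of the same kind, and the two chord kinds, are separated by their end vertices. *)
Lemma path_fun_inj h c c' i i' :
  path_valid c h i -> path_valid c' h i' ->
  (forall k, k <= h -> path_fun c i k = path_fun c' i' k) \/
  (forall k, k <= h -> path_fun c i k = path_fun c' i' (h - k)) ->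
  c = c' /\ i = i'.
Proof.
(* The claim is symmetric in the two paths, so six of the nine pairs of kinds suffice. *)
wlog : c c' i i' / match c, c' with
   | TailChord, Window | CycleChord, Window | CycleChord, TailChord => False
   | _, _ => True end.
  move=> WL v v' E.
  case cc : match c, c' with
   | TailChord, Window | CycleChord, Window | CycleChord, TailChord => false
   | _, _ => true end.
    by apply: WL => //; case: c c' cc {v v' E} => -[].
  have [||||-> ->] // := WL c' c i' i; first by case: c c' cc {v v' E} => -[].
  by case: E => E; [left|right] => k kh; rewrite E ?subKn ?leq_subr.
case: c c' => -[] // _ /=.
- move=> v v' [] E; split=> //; have := E 0 (leq0n _); have := E h (leqnn _); lia.
- move=> v /and3P[v1 v2 v3] [] E.
    have := E i' (ltnW v2); have := E i'.+1 v2; do ?case: ifP; lia.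
  have := E (h - i') (leq_subr _ _); have := E (h - i'.+1) (leq_subr _ _).
  rewrite !subKn ?(ltnW v2) //; do ?case: ifP; lia.
- move=> v /and3P[v1 v2 v3] [] E.
    have := E 0 (leq0n _); have := E 1 (ltn_trans v1 v2).
    by rewrite leq0n v1; lia.
  have := E (h - i') (leq_subr _ _); have := E (h - i'.+1) (leq_subr _ _).
  rewrite !subKn ?(ltnW v2) //; do ?case: ifP; lia.
- move=> /and3P[v1 v2 v3] /and3P[w1 w2 w3] [] E; split=> //; have := E 0 (leq0n _);
    rewrite ?leq0n; do ?case: ifP; lia.
- move=> /and3P[v1 v2 v3] /and3P[w1 w2 w3] [] E; have := E 0 (leq0n _);
    rewrite ?leq0n; do ?case: ifP; lia.
- move=> /and3P[v1 v2 v3] /and3P[w1 w2 w3] [] E; split=> //; have := E 0 (leq0n _);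
    have := E h (leqnn _); rewrite ?subn0 ?subnn ?leq0n; do ?case: ifP; lia.
Qed.

(* Transparent, so that == on concrete kinds reduces. *)
Lemma path_kind_eq_dec : comparable path_kind.
Proof. by move=> c c'; rewrite /decidable; decide equality. Defined.
HB.instance Definition _ := hasDecEq.Build path_kind (compareP path_kind_eq_dec).

(** The ranges solve [path_valid] for [i]; truncated subtraction turns the lower bound [h.+1 - n]
    into a maximum with 0 and makes impossible ranges empty. *)
Definition path_indices (h : nat) : seq (path_kind * nat) :=
  [seq (Window, i) | i <- iota 0 (m + n - h)] ++
  [seq (TailChord, i) | i <- iota (h.+1 - n) (minn m.+1 h - (h.+1 - n))] ++
  [seq (CycleChord, i) | i <- iota 1 (if h < n then h.-1 else 0)].

Lemma mem_path_indices h c i :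
  ((c, i) \in path_indices h) = path_valid c h i.
Proof.
have mapE (d : path_kind) s : ((c, i) \in [seq (d, j) | j <- s]) = (c == d) && (i \in s).
  apply/mapP/andP=> [[j js [-> ->]]|[/eqP-> js]]; first by [].
  by exists i.
rewrite !mem_cat !mapE !mem_iota; case: c {mapE} => /=; rewrite ?orbF /=.
- by apply/idP/idP; lia.
- by apply/idP/idP; lia.
- by case: ifP => ?; apply/idP/idP; lia.
Qed.

Lemma uniq_path_indices h : uniq (path_indices h).
Proof.
rewrite !cat_uniq !map_inj_uniq ?iota_uniq; try by move=> ? ? [].
rewrite /= andbT; apply/andP; split; apply/hasPn=> x; rewrite ?mem_cat.
  by case/orP=> /mapP[j _ ->]; apply/mapP=> -[].
by case/mapP=> [j _ ->]; apply/mapP=> -[].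
Qed.

Lemma size_path_indices h : size (path_indices h) =
  m + n - h + (minn m.+1 h - (h.+1 - n)) + (if h < n then h.-1 else 0).
Proof. by rewrite !size_cat !size_map !size_iota addnA. Qed.

(** * Transfer of the count to a graph numbered by [c], with inverse [d] *)

Section Chord.
Variables (G : sgraph) (c : G -> nat) (d : nat -> G).
Hypotheses (cK : cancel c d) (dK : forall k, k < m + n -> c (d k) = k).
Hypothesis c_lt : forall u, c u < m + n.
Hypothesis adjE : forall u v : G, adj u v = chord_adj (c u) (c v).

Lemma graph_walk_nat h (f : nat -> G) :
  graph_walk h f -> nat_walk h (c \o f).
Proof.
case=> f_adj f_inj; split=> [i _|i ih|i j ih jh /(can_inj cK)].
- exact: c_lt.
- by rewrite -adjE f_adj.
- exact: f_inj.
Qed.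

Lemma nat_walk_graph h (f : nat -> nat) :
  nat_walk h f -> graph_walk h (d \o f).
Proof.
case=> f_lt f_adj f_inj; split=> [i ih|i j ih jh /(congr1 c)] /=.
  by rewrite adjE !dK ?f_adj ?f_lt // ltnW.
by rewrite !dK ?f_lt //; apply: f_inj.
Qed.

(** The map [F] from valid parameters to path subgraphs is injective by [path_subgraph_inj] and
    [path_fun_inj], and reaches every path by [nat_walkP], a reversed walk having the same
    subgraph. *)
Lemma num_paths_chord h : num_paths G h = size (path_indices h).
Proof.
pose F (x : path_kind * nat) := path_subgraph h (d \o path_fun x.1 x.2).
have F_inj : {in path_indices h &, injective F}.
  move=> [a i] [b j]; rewrite !mem_path_indices => v w.
  have wv := path_fun_walk v; have ww := path_fun_walk w.
  have [lv _ _] := wv; have [lw _ _] := ww.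
  move/(path_subgraph_inj (nat_walk_graph wv) (nat_walk_graph ww)) => E.
  have [] := path_fun_inj w v; last by move=> -> ->.
  by case: E => E; [left|right] => k kh;
     have /(congr1 c) := E k kh; rewrite /= !dK ?lv ?lw ?leq_subr.
rewrite -(size_map F) -(card_uniqP _) ?map_inj_in_uniq ?uniq_path_indices //.
apply: eq_card => H; rewrite inE; apply/path_subgraphP/mapP.
  case=> f f_walk ->.
  have [a [i [v E]]] := nat_walkP (graph_walk_nat f_walk).
  exists (a, i); first by rewrite mem_path_indices.
  case: E => E; last rewrite -[RHS]rev_path_subgraph;
    by apply: eq_path_subgraph => k kh; rewrite /= -E // /= cK.
case=> -[a i]; rewrite mem_path_indices => v ->.
exists (d \o path_fun a i) => //.
exact: nat_walk_graph (path_fun_walk v).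
Qed.

End Chord.
End NatPaths.

(** * Numbering the lollipop and evaluating the count *)

Section Lollipop.
Variables (n1 n2 : nat) (n1_ge3 : 3 <= n1) (n2_ge2 : 2 <= n2).
Let L := lollipop n1_ge3 n2_ge2.
Let m := n2.-1.

(** The merged vertex gets [m] and the free end of the tail gets 0; the cycle edge between [n1 - 1]
    and 0 becomes the chord. *)
Definition lollipop_code (u : L) : nat :=
  match u with
  | inl a => m + (a : 'I_n1)
  | inr b => m - (val b : 'I_n2)
  end.

Lemma tail_gt0 k (kn : k < n2) :
  (Ordinal kn : path_graph n2) != Ordinal (ltnW n2_ge2) -> 0 < k.
Proof. by case: k kn => // kn /eqP[]; apply: val_inj. Qed.

Lemma lollipop_code_lt u : lollipop_code u < m + n1.
Proof. by case: u => [[a an]|b] /=; lia. Qed.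

Lemma lollipop_code_inj : injective lollipop_code.
Proof.
case=> [[a an]|[[b bn] /= b0]] [[a' an']|[[b' bn'] /= b0']];
  rewrite /lollipop_code /m /=; try have := tail_gt0 b0; try have := tail_gt0 b0'.
- by move=> E; congr inl; apply: val_inj => /=; lia.
- lia.
- lia.
- by move=> ? ? E; congr inr; apply: val_inj; apply: val_inj => /=; lia.
Qed.

Lemma lollipop_code_onto k : k < m + n1 -> exists u, lollipop_code u == k.
Proof.
move=> k_lt; have [mk|km] := leqP m k.
  have kn : k - m < n1 by lia.
  by exists (inl (Ordinal kn)) => /=; rewrite subnKC.
have kn : m - k < n2 by rewrite /m; lia.
have nz : (Ordinal kn : path_graph n2) != Ordinal (ltnW n2_ge2).
  by rewrite -val_eqE /=; lia.
by exists (inr (Sub (Ordinal kn : path_graph n2) nz)); rewrite /= subKn // ltnW.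
Qed.

Lemma lollipop_adjE u v :
  adj u v = chord_adj m n1 (lollipop_code u) (lollipop_code v).
Proof.
case: u v => [[a an]|[[b bn] /= b0]] [[a' an']|[[b' bn'] /= b0']] /=;
  rewrite /cycle_adj /path_adj /m -?val_eqE /=;
  try have := tail_gt0 b0; try have := tail_gt0 b0'.
(* Removing the modulus isolates the wrap-around edge and leaves linear arithmetic. *)
- have succ_mod j : j < n1 -> j.+1 %% n1 = if j.+1 == n1 then 0 else j.+1.
    by move=> jn; case: eqP => [->|?]; [rewrite modnn | rewrite modn_small //; lia].
  rewrite !succ_mod //.
  by do 2 case: ifP => ?; apply/idP/chord_adjP; lia.
- move=> ?; apply/idP/chord_adjP; lia.
- move=> ?; apply/idP/chord_adjP; lia.
- move=> ? ?; apply/idP/chord_adjP; lia.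
Qed.

Lemma num_paths_lollipop h : num_paths L h =
  n2.-1 + n1 - h + (minn n2 h - (h.+1 - n1)) + (if h < n1 then h.-1 else 0).
Proof.
(* A default that [d] returns only on numbers outside the range of the code. *)
have u0 : L by exact: (inl (Ordinal (ltnW (ltnW n1_ge3)))).
pose d k := odflt u0 [pick u | lollipop_code u == k].
have dK k : k < m + n1 -> lollipop_code (d k) = k.
  rewrite /d; case: pickP => [u /eqP //|none] /lollipop_code_onto[u].
  by rewrite none.
have cK : cancel lollipop_code d.
  by move=> u; apply: lollipop_code_inj; rewrite dK ?lollipop_code_lt.
rewrite (num_paths_chord n1_ge3 cK dK lollipop_code_lt lollipop_adjE).
by rewrite size_path_indices prednK // ltnW.
Qed.
End Lollipop.

Theorem theorem10 (n1 n2 h : nat) (n1_ge3 : 3 <= n1) (n2_ge2 : 2 <= n2)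
    (h_le : h <= n1 + n2 - 2) :
  let P := num_paths (lollipop n1_ge3 n2_ge2) h in
  [/\ (h = 0 \/ h = 1 -> P = n1 + n2 - 1),
      (2 <= h -> n2 <= n1 ->
        [/\ (2 <= h <= n2 - 1 -> P = n1 + n2 + h - 2),
            (n2 <= h <= n1 - 1 -> P = n1 + 2 * n2 - 2)
          & (n1 <= h <= n1 + n2 - 2 -> P = 2 * n1 + 2 * n2 - 2 * h - 2)])
    & (2 <= h -> n1 < n2 ->
        [/\ (2 <= h <= n1 - 1 -> P = n1 + n2 + h - 2),
            (n1 <= h <= n2 - 1 -> P = 2 * n1 + n2 - h - 2)
          & (n2 <= h <= n1 + n2 - 2 -> P = 2 * n1 + 2 * n2 - 2 * h - 2)])].
Proof.
(* [h < n1] decides whether the [CycleChord] term is present; the minimum and the truncated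
   subtractions yield the other case splits. *)
rewrite num_paths_lollipop /=; case: ifP => hn.
  by split=> [?|? ?|? ?]; [lia | split; lia | split; lia].
by split=> [?|? ?|? ?]; [lia | split; lia | split; lia].
Qed.
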